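(* Let $A\in\mathbb{R}^{n\times n}$ and let $\mathcal{K}\subseteq\mathbb{R}^n$ be a proper cone such that the system $\dot x = Ax$ is eventually $\mathcal{K}$-positive. Let $\tau_0\ge 0$ be such that $e^{At}\mathcal{K}\subseteq\mathcal{K}$ for all $t\ge\tau_0$, and define $$\widetilde{\mathcal{K}} = \left\{x\in\mathbb{R}^n \;\middle|\; e^{At}x\in\mathcal{K}\ \text{ for all } t\ge\tau_0\right\}.$$ Then: (i) the set $\widetilde{\mathcal{K}}$ is a proper cone; (ii) $e^{At}\widetilde{\mathcal{K}}\subseteq\widetilde{\mathcal{K}}$ for all $t\ge 0$.
   Context: A set $\mathcal{K}\subseteq\mathbb{R}^n$ is a proper cone if $\alpha\mathcal{K}\subseteq\mathcal{K}$ for all $\alpha>0$, $\mathcal{K}+\mathcal{K}\subseteq\mathcal{K}$, $\mathcal{K}\cap(-\mathcal{K})\subseteq\{0\}$, $\mathcal{K}$ is closed, and its interior is nonempty. The system $\dot x=Ax$ is eventually $\mathcal{K}$-positive if there exists $\tau_0\ge 0$ such that $e^{At}x\in\mathcal{K}$ for all $x\in\mathcal{K}$ and all $t\ge\tau_0$ (i.e. $\tau_0$ is uniform in $x$). *)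

(* Defs.v *)
From mathcomp Require Import all_boot all_order all_algebra.
From mathcomp Require Import all_classical all_reals.
From mathcomp Require Import topology normedtype sequences.

Set Implicit Arguments.
Unset Strict Implicit.
Unset Printing Implicit Defensive.

Import Order.TTheory GRing.Theory Num.Theory.
Import numFieldNormedType.Exports.

Local Open Scope classical_set_scope.
Local Open Scope ring_scope.

(* The limit is taken in the normed space 'M[R]_n (max norm); [lim] is total,
   but this series converges for every A. *)
Definition expmx (R : realType) (n : nat) (A : 'M[R]_n) : 'M[R]_n :=
  limn (series (fun k : nat => (k`!%:R)^-1 *: A ^+ k)).

Definition proper_cone (R : realType) (n : nat) (K : set 'cV[R]_n) : Prop :=
  [/\ forall a : R, 0 < a -> [set a *: x | x in K] `<=` K,
      [set x + y | x in K & y in K] `<=` K,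
      K `&` [set - x | x in K] `<=` [set 0],
      closed K
    & K° !=set0].

(* The threshold is uniform in the initial state x. *)
Definition eventually_positive (R : realType) (n : nat) (A : 'M[R]_n)
    (K : set 'cV[R]_n) : Prop :=
  exists2 tau0 : R, 0 <= tau0 &
    forall x, K x -> forall t : R, tau0 <= t -> K (expmx (t *: A) *m x).

Definition tilde_cone (R : realType) (n : nat) (A : 'M[R]_n)
    (K : set 'cV[R]_n) (tau0 : R) : set 'cV[R]_n :=
  [set x | forall t : R, tau0 <= t -> K (expmx (t *: A) *m x)].

(* Main.v *)
Require Import Defs.
From mathcomp Require Import all_boot all_order all_algebra.
From mathcomp Require Import all_classical all_reals.
From mathcomp Require Import topology normedtype sequences.
From mathcomp Require Import exp ring.

Set Implicit Arguments.
Unset Strict Implicit.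
Unset Printing Implicit Defensive.

Import Order.TTheory GRing.Theory Num.Theory.
Import numFieldNormedType.Exports.

Local Open Scope classical_set_scope.
Local Open Scope ring_scope.

(** Everything follows from two facts about the one-parameter family
    t |-> exp(tA): each exp(tA) is a continuous linear map, and
    exp((s+t)A) = exp(sA) exp(tA) with exp(0A) = 1 (lemmas [expmxD] and
    [expmx0]).  The cone [tilde_cone A K tau0] is the intersection, over
    t >= tau0, of the preimages of K under exp(tA).  So it inherits from K
    stability under sums and positive scalings by linearity, and closedness by
    continuity.  It is pointed because exp(tau0 A) is injective, with left
    inverse exp(-tau0 A).  It contains K by the choice of tau0, hence has an
    interior point.  Forward invariance is the semigroup law: for t >= 0,
    exp(sA) exp(tA) x = exp((s+t)A) x with s + t >= tau0 as soon as s >= tau0.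

    The substance is thus the semigroup law.  Write E_N(t) for the N-th
    partial sum of exp(tA).  The terms of the product E_N(s) E_N(t) are indexed
    by the square i, j < N; those below the antidiagonal i + j = N regroup,
    by the binomial formula, into E_N(s+t), and those on or above it form a
    remainder ([exp_coeff_square]).  This identity is purely formal, and holds with any
    sequence F k of vectors in place of the powers A^k.  Since |A^k| <= a^k for
    a = n|A| ([norm_mxX]), the remainder is bounded by the one for the scalar
    exponential at |s|a and |t|a.  That scalar remainder tends to 0
    ([exp_coeff_tail_cvg0]) precisely because exp (x + y) = exp x exp y for real
    x and y. *)

(** * The max norm and matrix products *)

Lemma norm_mx_entry (R : realType) m n (A : 'M[R]_(m, n)) i j :
  `|A i j| <= `|A|.
Proof.
rewrite [leRHS]/Num.norm /= mx_normrE.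
exact: (le_bigmax_cond _ (fun ij : 'I_m * 'I_n => `|A ij.1 ij.2|) (j := (i, j))).
Qed.

Lemma norm_mx_le (R : realType) m n (A : 'M[R]_(m, n)) (c : R) :
  0 <= c -> (forall i j, `|A i j| <= c) -> `|A| <= c.
Proof.
move=> c0 Ac; rewrite [leLHS]/Num.norm /= mx_normrE.
by apply: bigmax_le => // -[i j] _ /=.
Qed.

(** The max norm is submultiplicative only up to the inner dimension, since an
    entry of the product is a sum of n products of entries. *)
Lemma norm_mulmx (R : realType) m n p (A : 'M[R]_(m, n)) (B : 'M[R]_(n, p)) :
  `|A *m B| <= n%:R * `|A| * `|B|.
Proof.
apply: norm_mx_le => [|i j]; first by rewrite !mulr_ge0.
rewrite mxE (le_trans (ler_norm_sum _ _ _))//.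
rewrite -mulrA mulr_natl -[X in _ *+ X]card_ord -sumr_const.
by apply: ler_sum => k _; rewrite normrM ler_pM// norm_mx_entry.
Qed.

(** The base n|A| absorbs the factor n lost at each product; the case k = 0
    uses that the identity has norm at most 1 (it is 0 when n = 0). *)
Lemma norm_mxX (R : realType) n (A : 'M[R]_n) k :
  `|A ^+ k| <= (n%:R * `|A|) ^+ k.
Proof.
elim: k => [|k IH].
  rewrite !expr0; apply: norm_mx_le => // i j.
  by rewrite mxE; case: (i == j); rewrite ?normr1 ?normr0.
rewrite !exprS; apply: le_trans (norm_mulmx _ _) _.
by rewrite ler_pM// mulr_ge0.
Qed.

Lemma mulmx_continuous (R : realType) m n p (A : 'M[R]_(m, n)) :
  continuous (mulmx A : 'M[R]_(n, p) -> 'M[R]_(m, p)).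
Proof.
apply: bounded_linear_continuous; apply/linear_boundedP.
near=> r => B; apply: le_trans (norm_mulmx _ _) _.
by rewrite ler_wpM2r//; near: r; apply: nbhs_pinfty_ge; rewrite num_real.
Unshelve. all: by end_near. Qed.

(** Convergence is stated for one entry, where it reduces to finite sums and
    products of scalar limits; this suffices to identify a limit of matrices. *)
Lemma cvg_mulmx_entry (R : realType) m n p (u : ('M[R]_(m, n))^nat)
    (v : ('M[R]_(n, p))^nat) (A : 'M[R]_(m, n)) (B : 'M[R]_(n, p)) i j :
  u @ \oo --> A -> v @ \oo --> B ->
  (u N *m v N) i j @[N --> \oo] --> (A *m B) i j.
Proof.
move=> uA vB; rewrite mxE; under eq_fun do rewrite mxE.
apply: cvg_big => [|k _]; first exact: add_continuous.
apply: cvgM.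
  exact: (continuous_cvg _ (@coord_continuous R m n i k A) uA).
exact: (continuous_cvg _ (@coord_continuous R n p k j B) vB).
Qed.

(** Weierstrass test, from the Cauchy criterion and completeness of the space of
    matrices. *)
Lemma series_le_norm_cvg (R : realType) m n (u : ('M[R]_(m, n))^nat)
    (b : R^nat) :
  (forall k, `|u k| <= b k) -> cvgn (series b) -> cvgn (series u).
Proof.
move=> ub cb; apply: cauchy_cvg; apply/cauchy_seriesP => e e0.
have /cauchy_cvgP/cauchy_seriesP/(_ e e0) := cb.
apply: filterS => -[p q] /= h.
rewrite (le_lt_trans (ler_norm_sum _ _ _))// (le_lt_trans _ h)//.
by rewrite (le_trans _ (ler_norm _))// ler_sum.
Qed.

(** * Convergence of the exponential series *)

Lemma mxXZ (R : realType) n (A : 'M[R]_n) t k :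
  (t *: A) ^+ k = t ^+ k *: A ^+ k.
Proof.
elim: k => [|k IH]; first by rewrite !expr0 scale1r.
by rewrite !exprS IH /GRing.mul/= -scalemxAl -scalemxAr scalerA.
Qed.

(** The scalar t is kept in the coefficients, outside the powers of A, so that
    the partial sums for different t are combinations of the same A^k. *)
Definition expmx_sum (R : realType) n (A : 'M[R]_n) (t : R) : ('M[R]_n)^nat :=
  series (fun k => exp_coeff t k *: A ^+ k).

(** The terms are dominated by those of the scalar exponential at |t| n |A|. *)
Lemma expmx_sum_cvg (R : realType) n (A : 'M[R]_n) t :
  expmx_sum A t @ \oo --> expmx (t *: A).
Proof.
rewrite /expmx (_ : (fun k => _) = (fun k => exp_coeff t k *: A ^+ k)); last first.
  by apply/funext => k; rewrite mxXZ scalerA mulrC.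
apply: (@series_le_norm_cvg _ _ _ _ (exp_coeff (`|t| * (n%:R * `|A|)))).
  move=> k; rewrite normrZ /exp_coeff/= normrM normrX normfV normr_nat exprMn.
  by rewrite [leRHS]mulrAC ler_wpM2l ?norm_mxX// mulr_ge0// ?exprn_ge0// invr_ge0.
exact: is_cvg_series_exp_coeff.
Qed.

(** * The semigroup law *)

(** The binomial formula, divided by k!. *)
Lemma exp_coeffD (R : realType) (x y : R) k :
  exp_coeff (x + y) k =
  \sum_(0 <= i < k.+1) exp_coeff x i * exp_coeff y (k - i)%N.
Proof.
rewrite /exp_coeff/= addrC exprDn mulr_suml big_mkord.
apply: eq_bigr => i _; have ik : (i <= k)%N by rewrite -ltnS.
have := bin_fact ik => /(congr1 (fun m => m%:R : R)); rewrite !natrM => <-.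
have f0 m : m`!%:R != 0 :> R by rewrite pnatr_eq0 -lt0n fact_gt0.
have b0 : 'C(k, i)%:R != 0 :> R by rewrite pnatr_eq0 -lt0n bin_gt0.
rewrite -mulr_natr.
by field; rewrite f0 f0 b0.
Qed.

(** The terms with i + j < N are grouped by k = i + j and summed by the binomial
    formula; nothing is assumed on F, so that the identity serves both for
    powers of a matrix and, with F constant, for scalars. *)
Lemma exp_coeff_square (R : realType) (V : lmodType R) (F : nat -> V) s t N :
  \sum_(0 <= i < N) \sum_(0 <= j < N)
      (exp_coeff s i * exp_coeff t j) *: F (i + j)%N =
  \sum_(0 <= k < N) exp_coeff (s + t) k *: F k +
  \sum_(0 <= i < N) \sum_(0 <= j < N | (N <= i + j)%N)
      (exp_coeff s i * exp_coeff t j) *: F (i + j)%N.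
Proof.
transitivity (\sum_(0 <= i < N)
   (\sum_(0 <= j < N | (i + j < N)%N)
      (exp_coeff s i * exp_coeff t j) *: F (i + j)%N +
    \sum_(0 <= j < N | (N <= i + j)%N)
      (exp_coeff s i * exp_coeff t j) *: F (i + j)%N)).
  apply: eq_bigr => i _; rewrite (bigID (fun j => (i + j < N)%N))/=.
  by congr +%R; apply: eq_bigl => j; rewrite -leqNgt.
rewrite big_split/=; congr +%R; symmetry.
transitivity (\sum_(0 <= k < N) \sum_(0 <= i < N | (i <= k)%N)
    (exp_coeff s i * exp_coeff t (k - i)%N) *: F k).
  apply: eq_big_nat => k kN; rewrite exp_coeffD scaler_suml.
  by rewrite (big_nat_widen _ _ N).
(* For fixed i, the index k with i <= k < N becomes j = k - i < N - i. *)
rewrite (exchange_big_dep_nat xpredT)//=; apply: eq_big_nat => i iN.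
have iN' : (i <= N)%N by apply: ltnW.
rewrite -(big_nat_widenl i 0 N xpredT)// -[X in \sum_(X <= _ < _) _]add0n big_addn.
rewrite (big_nat_widen _ _ N) ?leq_subr//=.
apply: eq_big => [j|j _]; first by rewrite ltn_subRL.
by rewrite addnK addnC.
Qed.

(** This remainder is the difference between the product of the partial sums for
    x and y and the partial sum for x + y, so its limit is
    exp x exp y - exp (x + y). *)
Lemma exp_coeff_tail_cvg0 (R : realType) (x y : R) :
  (\sum_(0 <= i < N) \sum_(0 <= j < N | (N <= i + j)%N)
     exp_coeff x i * exp_coeff y j) @[N --> \oo] --> (0 : R).
Proof.
rewrite (_ : (fun N => _) = (fun N =>
    series (exp_coeff x) N * series (exp_coeff y) N -
    series (exp_coeff (x + y)) N)); last first.
  apply/funext => N; rewrite /series/= big_distrlr/=.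
  have := @exp_coeff_square R R^o (fun=> 1) x y N.
  rewrite /GRing.scale/=.
  under eq_bigr do under eq_bigr do rewrite mulr1.
  under [X in _ = X + _ -> _]eq_bigr do rewrite mulr1.
  under [X in _ = _ + X -> _]eq_bigr do under eq_bigr do rewrite mulr1.
  by move=> ->; rewrite addrAC subrr add0r.
rewrite (_ : 0 = expR x * expR y - expR (x + y)); last by rewrite expRD subrr.
by apply: cvgB; [apply: cvgM|]; apply: is_cvg_series_exp_coeff.
Qed.

Lemma expmxD (R : realType) n (A : 'M[R]_n) s t :
  expmx ((s + t) *: A) = expmx (s *: A) *m expmx (t *: A).
Proof.
pose T N := \sum_(0 <= i < N) \sum_(0 <= j < N | (N <= i + j)%N)
      (exp_coeff s i * exp_coeff t j) *: A ^+ (i + j).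
have sumM N : expmx_sum A s N *m expmx_sum A t N = expmx_sum A (s + t) N + T N.
  rewrite -exp_coeff_square /expmx_sum /series/= mulmx_suml.
  apply: eq_bigr => i _; rewrite mulmx_sumr; apply: eq_bigr => j _.
  by rewrite -scalemxAl -scalemxAr scalerA exprD.
(* The remainder is dominated by the scalar one at |s|a and |t|a. *)
have T0 : T @ \oo --> (0 : 'M[R]_n).
  apply: norm_cvg0.
  have [a Aa] : exists a, forall k, `|A ^+ k| <= a ^+ k.
    by exists (n%:R * `|A|) => k; exact: norm_mxX.
  apply: squeeze_cvgr (exp_coeff_tail_cvg0 (`|s| * a) (`|t| * a)); last exact: cvg_cst.
  apply: nearW => N; rewrite normr_ge0/=.
  apply: le_trans (ler_norm_sum _ _ _) _; apply: ler_sum => i _.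
  apply: le_trans (ler_norm_sum _ _ _) _; apply: ler_sum => j _.
  rewrite normrZ /exp_coeff/= !normrM !normrX !normfV !normr_nat !exprMn.
  rewrite [leRHS](_ : _ = `|s| ^+ i / i`!%:R * (`|t| ^+ j / j`!%:R) * a ^+ (i + j)).
    by rewrite ler_wpM2l// !mulr_ge0// ?exprn_ge0// invr_ge0.
  by rewrite exprD; ring.
(* Entrywise, E_N(s) E_N(t) = E_N(s+t) + T N has two limits, which coincide. *)
apply/matrixP => i j.
have prod_cvg := cvg_mulmx_entry (i := i) (j := j)
  (@expmx_sum_cvg R n A s) (@expmx_sum_cvg R n A t).
apply/esym; apply: (cvg_unique _ prod_cvg) => //=.
rewrite (funext (fun N => congr1 (fun M : 'M_n => M i j) (sumM N))).
apply: (continuous_cvg _ (@coord_continuous R n n i j _)).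
by rewrite -[expmx _]addr0; apply: cvgD => //; exact: expmx_sum_cvg.
Qed.

Lemma expmx0 (R : realType) n (A : 'M[R]_n) : expmx (0 *: A) = 1%:M.
Proof.
apply: (@cvg_unique _ (@norm_hausdorff _ _) _ _ _ _ (@expmx_sum_cvg R n A 0)).
(* The term of index 0 is 1 and all others vanish, so every partial sum other
   than the empty one is already the limit. *)
apply: cvg_near_cst; exists 1%N => // -[//|N] _ /=.
rewrite /expmx_sum /series/= big_nat_recl//= big1 => [|k _].
  by rewrite /exp_coeff/= !expr0 fact0 divr1 scale1r addr0.
by rewrite /exp_coeff/= expr0n mul0r scale0r.
Qed.

Lemma expmx_mulmx_inj (R : realType) n (A : 'M[R]_n) t p :
  injective (mulmx (expmx (t *: A)) : 'M[R]_(n, p) -> 'M[R]_(n, p)).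
Proof.
apply: (can_inj (g := mulmx (expmx (- t *: A)))) => x.
by rewrite mulmxA -expmxD addNr expmx0 mul1mx.
Qed.

(** * The cone of states whose trajectory lies in K from time tau0 on *)

Theorem theorem1 (R : realType) (n : nat) (A : 'M[R]_n) (K : set 'cV[R]_n)
    (K_proper : proper_cone K) (AK : eventually_positive A K)
    (tau0 : R) (tau0_ge0 : 0 <= tau0)
    (tau0K : forall t : R, tau0 <= t ->
       [set expmx (t *: A) *m x | x in K] `<=` K) :
  proper_cone (tilde_cone A K tau0) /\
  (forall t : R, 0 <= t ->
     [set expmx (t *: A) *m x | x in tilde_cone A K tau0]
       `<=` tilde_cone A K tau0).
Proof.
have [Kscale Kadd Kpointed Kclosed [x0 Kx0]] := K_proper.
split; last first.
  move=> t t0 _ [x Kx <-] s tau0s.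
  by rewrite mulmxA -expmxD; apply: Kx; rewrite ler_wpDr.
split.
- move=> a a0 _ [x Kx <-] t tau0t; rewrite -scalemxAr.
  by apply: (Kscale _ a0); exists (expmx (t *: A) *m x) => //; exact: Kx.
- move=> _ [x Kx [y Ky <-]] t tau0t; rewrite mulmxDr; apply: Kadd.
  exists (expmx (t *: A) *m x); first exact: Kx.
  by exists (expmx (t *: A) *m y) => //; exact: Ky.
- move=> x [Kx [y Ky yx]].
  apply: (@expmx_mulmx_inj _ _ A tau0); rewrite mulmx0; apply: Kpointed.
  split; first exact: Kx.
  exists (expmx (tau0 *: A) *m y); first exact: Ky.
  by rewrite -yx mulmxN.
- rewrite (_ : tilde_cone _ _ _ =
    \bigcap_(t in [set t | tau0 <= t]) (mulmx (expmx (t *: A)) @^-1` K))//.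
  apply: closed_bigI => t _.
  by have /continuous_closedP := @mulmx_continuous R n n 1 (expmx (t *: A)); apply.
- exists x0; apply: (interiorS _ Kx0) => x Kx t tau0t.
  by apply: (tau0K _ tau0t); exists x.
Qed.
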